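(* Let $S$ be a compact topological semigroup. Then the following are equivalent: (i) $S$ is homeomorphic to a subspace of $\mathbb{N}^{\mathbb{N}}$ (and $I_{\mathbb{N}}$); (ii) $S$ embeds topologically into $\mathbb{N}^{\mathbb{N}}$; (iii) $S$ is metrizable and totally disconnected.
   Context: A topological semigroup is a semigroup with a topology for which multiplication is continuous. A space is totally disconnected if its only connected subsets are singletons. $\mathbb{N}^{\mathbb{N}}$ is the monoid of all functions $\mathbb{N}\to\mathbb{N}$ under composition (functions act on the right and compose from left to right), with the product topology arising from the discrete topology on $\mathbb{N}$. $I_{\mathbb{N}}$ is the symmetric inverse monoid of all partial permutations of $\mathbb{N}$ (bijections between subsets of $\mathbb{N}$) under composition of binary relations, with the topology generated by the subbasis consisting of the sets $U_{x,y}=\{h : (x,y)\in h\}$, $W_x=\{h : x\notin\operatorname{dom}(h)\}$ and $W_x^{-1}=\{h : x\notin\operatorname{im}(h)\}$, for $x,y\in\mathbb{N}$. The spaces $\mathbb{N}^{\mathbb{N}}$ and $I_{\mathbb{N}}$ are homeomorphic (though not isomorphic as monoids), so in (i) being homeomorphic to a subspace of one is equivalent to being homeomorphic to a subspace of the other. An embedding of semigroups is an injective homomorphism; an embedding $\phi:S\to T$ of topological semigroups is topological if both $\phi$ and $\phi^{-1}:(S)\phi\to S$ are continuous, where $(S)\phi$ has the subspace topology. ''$S$ embeds topologically into $T$'' means such a topological embedding exists. *)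

(* Defs.v *)
From HB Require Import structures.
From mathcomp Require Import all_boot all_order all_algebra.
From mathcomp Require Import all_classical all_reals.
From mathcomp Require Import topology.

Set Implicit Arguments.
Unset Strict Implicit.
Unset Printing Implicit Defensive.

Local Open Scope classical_set_scope.

HB.structure Definition PreTopologicalMagma := {S of Topological S & Magma S}.

HB.mixin Record PreTopologicalMagma_isTopologicalMagma S
    & PreTopologicalMagma S := {
  mulg_continuous : continuous (fun p : S * S => (p.1 * p.2)%g)
}.

#[short(type="topologicalSemigroupType")]
HB.structure Definition TopologicalSemigroup :=
  {S of Topological S & Semigroup S & PreTopologicalMagma_isTopologicalMagma S}.

Definition homeomorphic (X Y : topologicalType) : Prop :=
  exists (f : X -> Y) (g : Y -> X),
    [/\ cancel f g, cancel g f, continuous f & continuous g].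

Definition homeomorphic_to_subspace (X Y : topologicalType) : Prop :=
  exists A : set Y, homeomorphic X (set_type A).

Definition metrizable (R : realType) (X : topologicalType) : Prop :=
  exists M : metricType R, homeomorphic X M.

(* [psi] is the inverse of [phi] on its range, [range phi] carrying the
   subspace topology. *)
Definition topological_embedding (S T : topologicalSemigroupType)
    (phi : {multiplicative S -> T}) : Prop :=
  [/\ injective phi, continuous phi
    & exists2 psi : set_type (range phi) -> S,
        forall y, phi (psi y) = set_val y & continuous psi].

Definition embeds_topologically (S T : topologicalSemigroupType) : Prop :=
  exists phi : {multiplicative S -> T}, topological_embedding phi.

Definition full_transf : Type := prod_topology (fun _ : nat => nat).

HB.instance Definition _ := Topological.on full_transf.

(* Functions act on the right: the product f * g applies f first. *)
Definition transf_mul (f g : full_transf) : full_transf := fun x => g (f x).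

Lemma transf_mulA : associative transf_mul. Proof. by []. Qed.
Lemma transf_mul1g : left_id (id : full_transf) transf_mul. Proof. by []. Qed.
Lemma transf_mulg1 : right_id (id : full_transf) transf_mul. Proof. by []. Qed.

HB.instance Definition _ :=
  isMonoid.Build full_transf transf_mulA transf_mul1g transf_mulg1.

Lemma transf_mulE (f g : full_transf) (x : nat) : (f * g)%g x = g (f x).
Proof. by []. Qed.

Lemma transf_mul_continuous :
  continuous (fun p : full_transf * full_transf => (p.1 * p.2)%g).
Proof.
have coord (f : full_transf) (k : nat) :
    \forall g \near f, (g : full_transf) k = f k.
  have := @proj_continuous nat (fun _ => nat) k f [set f k].
  by apply; rewrite nbhs_principalE.
move=> [f g]; apply/cvg_sup => x.
apply/cvg_image.
  by apply/seteqP; split=> // y _; exists (fun=> y).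
move=> A /=; rewrite nbhs_principalE => /principal_filterP Afx.
exists [set h : full_transf | A (h x)]; last first.
  apply/seteqP; split=> [y [h Ah <-]//|y Ay].
  by exists (fun=> y).
have Hf := coord f x; have Hg := coord g (f x).
exists ([set f' : full_transf | f' x = f x],
        [set g' : full_transf | g' (f x) = g (f x)]) => //.
move=> [f' g'] /= [Hf' Hg'].
by rewrite transf_mulE Hf' Hg'.
Qed.

HB.instance Definition _ :=
  PreTopologicalMagma_isTopologicalMagma.Build full_transf
    transf_mul_continuous.

(* The functional and injective relations on nat, i.e. the bijections between
   subsets of nat; only the topology of the symmetric inverse monoid is used,
   so its product is not defined. *)
Record partial_perm := PartialPerm {
  graph : set (nat * nat);
  graph_functional : forall x y z, graph (x, y) -> graph (x, z) -> y = z;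
  graph_injective : forall x y z, graph (x, z) -> graph (y, z) -> x = y
}.

HB.instance Definition _ := gen_eqMixin partial_perm.
HB.instance Definition _ := gen_choiceMixin partial_perm.

Definition partial_perm_subbasis : set (set partial_perm) :=
  [set U | exists x y : nat, U = [set h | graph h (x, y)]] `|`
  [set W | exists x : nat, W = [set h | ~ (graph h).`1 x]] `|`
  [set W | exists x : nat, W = [set h | ~ (graph h).`2 x]].

HB.instance Definition _ :=
  isSubBaseTopological.Build partial_perm partial_perm_subbasis id.

(* Main.v *)
From HB Require Import structures.
From mathcomp Require Import finmap.
Require Import Defs.
From mathcomp Require Import all_boot all_order all_algebra.
From mathcomp Require Import all_classical all_reals.
From mathcomp Require Import topology.

Set Implicit Arguments.
Unset Strict Implicit.
Unset Printing Implicit Defensive.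

Import Order.TTheory GRing.Theory Num.Theory.
Local Open Scope classical_set_scope.

(** All three conditions amount, for a compact space, to the existence of
countably many clopen sets [C n] that separate points
([countably_clopen_separated]).

This property holds for both target spaces, whose subbasic sets given by pairs of
natural numbers are clopen, and it is inherited along continuous injections; so
it follows from either embedding condition. Conversely the memberships in the
sets [C n] define a continuous injection into each of the two spaces, and a
continuous injection of a compact space into a Hausdorff space is an embedding.
The same memberships define an ultrametric for the topology, and clopen sets that
separate points make the space totally disconnected. In the other direction, a
compact metrizable totally disconnected space is zero-dimensional
([compact_totally_disconnected_zero_dimensional]) and has only countably many
clopen sets ([compact_metric_clopen_separated]).

It remains to pass from separating clopen sets to an embedding that respects the
product. For a clopen subset [C] of [S], let [x] and [y] be equivalent if [x * u]
and [y * u] are in [C] for the same [u], where [u] may also be an adjoined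
identity. This is a right congruence, and by compactness of [S] and continuity of
the product its classes are open ([right_syntactic_open]), so there are finitely
many. Hence [S] acts on the right on the classes, and the adjoined identity
contributes one more point, sent by [s] to the class of [s]. Taking all the sets
[C n] at once, [S] acts on a countable set; the action is faithful because the
sets [C n] separate points, and it depends continuously on [s] because the
classes are open. It is therefore a topological embedding into the
transformations of [nat] ([compact_clopen_separated_embeds]). *)

(** * Compact spaces, Hausdorff spaces and zero-dimensionality *)

Lemma compact_closed_image (X Y : topologicalType) (f : X -> Y) (A : set X) :
  compact [set: X] -> hausdorff_space Y -> continuous f ->
  closed A -> closed (f @` A).
Proof.
move=> cX hY cf cA; apply: compact_closed => //.
apply: continuous_compact; first exact: continuous_subspaceT.
exact: subclosed_compact cX _.
Qed.

(** The usual closed-map argument: closed subsets of [X] are compact, so their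
images are closed in the Hausdorff space [Y], and the set-theoretic inverse
pulls open sets back to relatively open sets. Every embedding below comes from
this lemma, so only continuity and injectivity ever need a construction. *)
Lemma compact_injective_inverse (X Y : topologicalType) (f : X -> Y) :
  compact [set: X] -> hausdorff_space Y -> continuous f -> injective f ->
  exists2 g : set_type (range f) -> X,
    forall y, f (g y) = set_val y & continuous g.
Proof.
move=> cX hY cf fI.
have ex (y : set_type (range f)) : {x | f x = set_val y}.
  by apply: cid; have [x _ fx] := set_mem (valP y); exists x; rewrite fx.
exists (fun y => projT1 (ex y)) => [y|]; first exact: projT2 (ex y).
apply/continuousP => U oU; exists (~` (f @` (~` U))).
  by apply/closed_openC/compact_closed_image => //; exact: open_closedC.
apply/seteqP; split => y /=; have fy := projT2 (ex y).
- by apply: contra_notP => nU; exists (projT1 (ex y)).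
- by move=> Uy [x nUx fx]; apply: nUx; rewrite -(fI _ _ (etrans fy (esym fx))).
Qed.

Lemma compact_homeomorphic_to_subspace (X Y : topologicalType) (f : X -> Y) :
  compact [set: X] -> hausdorff_space Y -> continuous f -> injective f ->
  homeomorphic_to_subspace X Y.
Proof.
move=> cX hY cf fI.
have [g fg cg] := compact_injective_inverse cX hY cf fI.
exists (range f).
exists (fun x => exist _ (f x) (mem_set (imageP f I)) : set_type (range f)), g.
split=> //.
- by move=> x; apply: fI; rewrite fg.
- by move=> y; apply/val_inj; rewrite /= fg.
- exact: continuous_comp_initial.
Qed.

Lemma zero_dimensional_hausdorff (X : topologicalType) :
  zero_dimensional X -> hausdorff_space X.
Proof.
move=> zX x y clxy; apply: contrapT => /eqP /zX[U [[oU cU] Ux nUy]].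
have [z []] // := clxy U (~` U) (open_nbhs_nbhs (conj oU Ux))
  (open_nbhs_nbhs (conj (closed_openC cU) nUy)).
Qed.

(** The Heine-Borel property in the form used below, for a space that is
allowed to be empty. *)
Lemma compact_finite_subcover (X : topologicalType) (I : choiceType)
    (D : set I) (f : I -> set X) :
  compact [set: X] -> (forall i, D i -> open (f i)) ->
  (forall x, exists2 i, D i & f i x) ->
  exists2 s : seq I, forall i, i \in s -> D i
    & forall x, exists2 i, i \in s & f i x.
Proof.
move=> cX fo fcov.
have [[x0 _]|X0] := pselect ([set: X] !=set0); last first.
  by exists [::] => // x; case: X0; exists x.
pose pX : ptopologicalType := HB.pack (Topological.sort X)
  (Topological.class X) (isPointed.Build X x0).
have : @compact pX setT by [].
rewrite compact_cover => /(_ I D f fo)[|s sD scov].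
  by move=> x _; have [i Di fix_] := fcov x; exists i.
exists (enum_fset s) => [i /sD|x]; first by move/set_mem.
by have [//|i si fi] := scov x; exists i.
Qed.

(** The complement of [K] together with the complements of the clopen
neighbourhoods of [x] cover the space; a finite subcover leaves a finite
intersection of clopen neighbourhoods that misses [K]. *)
Lemma clopen_disjoint_of_closed (X : topologicalType) (x : X) (K : set X) :
  compact [set: X] -> closed K ->
  (forall y, K y -> exists C, [/\ clopen C, C x & ~ C y]) ->
  exists C, [/\ clopen C, C x & C `&` K = set0].
Proof.
move=> cX cK sep.
have [||s sD scov] := @compact_finite_subcover X (set X)
  [set C | clopen C /\ C x] (fun C => ~` C `|` ~` K) cX.
- move=> C [[_ cC] _]; apply: openU; exact: closed_openC.
- move=> y; have [Ky|nKy] := pselect (K y).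
    by have [C [cC Cx nCy]] := sep y Ky; exists C => //; left.
  by exists setT; [split=> //; exact: clopenT|right].
exists (\big[setI/setT]_(C <- s) C); split.
- rewrite big_seq; elim/big_ind : _ => [||C /sD[]//].
  + exact: clopenT.
  + by move=> A B; exact: clopenI.
- by rewrite big_seq; elim/big_ind : _ => // C /sD[].
- apply/seteqP; split=> // y [sy Ky].
  have [C Cs] := scov y; case=> // nCy; apply: nCy.
  by move: sy; rewrite (big_rem C) //= => -[].
Qed.

(** In a compact Hausdorff space the quasi-component [Q] of [x], that is the
intersection of the clopen neighbourhoods of [x], is connected, hence it is the
connected component of [x]. So points that no clopen set separates from [x] lie
in its component, which is trivial when the space is totally disconnected. *)
Lemma compact_totally_disconnected_zero_dimensional (X : topologicalType) :
  compact [set: X] -> hausdorff_space X -> totally_disconnected [set: X] ->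
  zero_dimensional X.
Proof.
move=> cX hX tdX x y xy; apply: contrapT => noC.
pose Q := [set z | forall C : set X, clopen C -> C x -> C z].
have Qx : Q x by move=> C.
have Qy : Q y by move=> C cC Cx; apply: contrapT => nCy; apply: noC; exists C.
have clQ : closed Q.
  rewrite (_ : Q = \bigcap_(C in [set C | clopen C /\ C x]) C).
    by apply: closed_bigI => C [[]].
  by apply/seteqP; split=> z Qz C => [[cC Cx]|cC Cx]; exact: Qz.
suff cQ : connected Q.
  have : connected_component [set: X] x y by exists Q.
  by rewrite tdX // => yx; rewrite yx eqxx in xy.
(* Let A be a relatively clopen part of Q that contains x. Normality gives a
   neighbourhood U of A whose closure misses Q \ A; its frontier is then
   disjoint from Q, so some clopen C around x avoids the frontier. The trace of
   U on C is a clopen neighbourhood of x, hence contains Q, and A = Q. *)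
have main (A : set X) : A x -> (exists2 O, open O & A = Q `&` O) ->
    (exists2 F, closed F & A = Q `&` F) -> A = Q.
  move=> Ax [O oO AO] [F cF AF].
  have clA : closed A by rewrite AF; exact: closedI.
  have clB : closed (Q `&` ~` O) by apply: closedI => //; exact: open_closedC.
  have nB : set_nbhs A (~` (Q `&` ~` O)).
    move=> z Az; apply: open_nbhs_nbhs; split; first exact: closed_openC.
    by move=> [_]; apply; move: Az; rewrite AO => -[].
  have [U nU UB] := compact_normal hX cX clA nB.
  have AU : A `<=` U° by move=> z /nU.
  have [||C [cC Cx CK]] :=
    @clopen_disjoint_of_closed X x (closure U `&` ~` U°) cX.
  - apply: closedI; first exact: closed_closure.
    exact/open_closedC/open_interior.
  - move=> z [Uz nUz]; apply: contrapT => nC; apply: nUz; apply: AU.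
    rewrite AO; suff Qz : Q z.
      split=> //; apply: contrapT => nOz.
      by apply: (UB z Uz); split.
    by move=> C cC Cx; apply: contrapT => nCz; apply: nC; exists C.
  have CU : C `&` U° = C `&` closure U.
    apply/seteqP; split=> z [Cz Uz]; split=> //.
      exact: subset_closure (interior_subset Uz).
    apply: contrapT => nUz; suff : (set0 : set X) z by [].
    by rewrite -CK; split.
  have cCU : clopen (C `&` U°).
    split; first by apply: openI; [case: cC|exact: open_interior].
    by rewrite CU; apply: closedI; [case: cC|exact: closed_closure].
  apply/seteqP; split=> [z|z Qz]; first by rewrite AO => -[].
  have [Cz Uz] := Qz _ cCU (conj Cx (AU _ Ax)).
  rewrite AO; split=> //; apply: contrapT => nOz.
  apply: (UB z); last by split.
  exact: subset_closure (interior_subset Uz).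
(* A relatively clopen part that misses x is handled by its complement. *)
move=> A [z Az] [O oO AO] [F cF AF].
have [Ax|nAx] := pselect (A x); first by apply: main; [|exists O|exists F].
exfalso.
have : Q `&` ~` A = Q.
  apply: main => //.
  - exists (~` F); first exact: closed_openC.
    by rewrite AF setCI setIUr setICr set0U.
  - exists (~` O); first exact: open_closedC.
    by rewrite AO setCI setIUr setICr set0U.
have Qz : Q z by move: Az; rewrite AO => -[].
by move/seteqP => [_ /(_ z Qz)[]].
Qed.

(** * Countable families of clopen sets that separate points *)

Definition clopen_separation (X : topologicalType) (I : Type)
    (C : I -> set X) : Prop :=
  (forall i, clopen (C i)) /\
  (forall x y, (forall i, C i x <-> C i y) -> x = y).

(** The hub of all the implications: a compact space has this property exactly
when it is homeomorphic to a closed subset of the Cantor space. *)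
Definition countably_clopen_separated (X : topologicalType) : Prop :=
  exists C : nat -> set X, clopen_separation C.

Lemma clopen_separation_countType (X : topologicalType) (I : countType)
    (C : I -> set X) :
  clopen_separation C -> countably_clopen_separated X.
Proof.
move=> [cC sC].
exists (fun n => if unpickle n is Some i then C i else set0); split.
  by move=> n; case: unpickle => [i|]; [exact: cC|exact: clopen0].
by move=> x y xy; apply: sC => i; have := xy (pickle i); rewrite pickleK.
Qed.

Lemma countably_clopen_separated_injective (X Y : topologicalType)
    (f : X -> Y) :
  continuous f -> injective f ->
  countably_clopen_separated Y -> countably_clopen_separated X.
Proof.
move=> cf fI [C [cC sC]]; exists (fun n => f @^-1` C n); split.
  by move=> n; exact: preimage_clopen.
by move=> x y xy; apply/fI/sC.
Qed.

Lemma homeomorphic_to_subspace_injective (X Y : topologicalType) :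
  homeomorphic_to_subspace X Y ->
  exists2 f : X -> Y, continuous f & injective f.
Proof.
move=> [A [f [g [fK _ cf _]]]]; exists (set_val \o f).
  move=> x; apply: continuous_comp; [exact: cf|exact: initial_continuous].
by move=> x y /val_inj /(can_inj fK).
Qed.

(** If no clopen set separates [x] from [y], then neither does any [C n] or
its complement, and the separation hypothesis forces [x = y]. *)
Lemma countably_clopen_separated_zero_dimensional (X : topologicalType) :
  countably_clopen_separated X -> zero_dimensional X.
Proof.
move=> [C [cC sC]] x y xy; apply: contrapT => noU; move/eqP: xy; apply.
apply: sC => n; split=> Cn; apply: contrapT => nCn; apply: noU.
  by exists (C n).
by exists (~` C n); split=> //; exact: (clopenC setT (cC n)).
Qed.

(** * The two universal spaces *)

(** The coordinates take values in a discrete space, so it is enough that the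
fibres of each coordinate be open. *)
Lemma continuous_full_transf (X : topologicalType) (f : X -> full_transf) :
  (forall k n, open [set x | f x k = n]) -> continuous f.
Proof.
move=> of_ x; apply/cvg_sup => k.
apply/cvg_image; first by apply/seteqP; split=> // y _; exists (fun=> y).
move=> A /=; rewrite nbhs_principalE => /principal_filterP Afx.
exists [set h : full_transf | A (h k)]; last first.
  by apply/seteqP; split=> [y [h Ah <-]//|y Ay]; exists (fun=> y).
apply: (@filterS _ _ _ [set y | f y k = f x k]) => [y /= ->//|].
exact: open_nbhs_nbhs.
Qed.

Lemma full_transf_clopen_separated : countably_clopen_separated full_transf.
Proof.
apply: (@clopen_separation_countType _ (nat * nat)%type
  (fun p => [set f : full_transf | f p.1 = p.2])); split.
  move=> [k n]; apply: (@preimage_clopen full_transf nat (fun f => f k) [set n]).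
    by split; [exact: discrete_open|exact: discrete_closed].
  exact: (@proj_continuous nat (fun=> nat)).
move=> f g fg; apply/funext => k.
by have /= [/(_ erefl) ->] := fg (k, f k).
Qed.

Lemma open_partial_perm_subbasis (U : set partial_perm) :
  partial_perm_subbasis U -> open U.
Proof.
move=> sU; exists [set U]; last by rewrite bigcup_set1.
move=> _ ->; exists [fset U]%fset; last by rewrite set_fset1 bigcap_set1.
by move=> V /fset1P ->; apply: mem_set.
Qed.

Lemma continuous_partial_perm (X : topologicalType) (f : X -> partial_perm) :
  (forall U, partial_perm_subbasis U -> open (f @^-1` U)) -> continuous f.
Proof.
move=> of_; apply/continuousP => _ [D sD <-].
rewrite preimage_bigcup; apply: bigcup_open => _ /sD[E sE <-].
rewrite preimage_bigcap bigcap_fset big_seq.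
elim/big_ind : _ => [||U UE]; [exact: openT|exact: openI|].
by apply: of_; have /set_mem := sE _ UE.
Qed.

(** Partial permutations are separated by their pairs. The set of those that
contain [(x, y)] is closed, because a partial permutation that omits [(x, y)]
either is undefined at [x] or contains some [(x, z)] with [z <> y], and both
conditions are subbasic. *)
Lemma partial_perm_clopen_separated : countably_clopen_separated partial_perm.
Proof.
apply: (@clopen_separation_countType _ (nat * nat)%type
  (fun p => [set h : partial_perm | graph h p])); split.
  move=> [x y]; split.
    by apply: open_partial_perm_subbasis; left; left; exists x, y.
  rewrite -openC (_ : ~` _ = [set h | ~ (graph h).`1 x] `|`
    \bigcup_(z in [set z | z <> y]) [set h | graph h (x, z)]).
    apply: openU; last apply: bigcup_open => z _.
      by apply: open_partial_perm_subbasis; left; right; exists x.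
    by apply: open_partial_perm_subbasis; left; left; exists x, z.
  apply/seteqP; split=> h /=.
    move=> nh; have [[z hz]|] := pselect ((graph h).`1 x); last by left.
    by right; exists z => // zy; apply: nh; rewrite -zy.
  move=> [nh hxy|[z zy hz] hxy]; first by apply: nh; exists y.
  by apply: zy; exact: graph_functional hz hxy.
move=> [g gf gi] [h hf hi] /= gh.
have E : g = h by apply/funext => p; apply/propext; exact: gh.
by subst h; congr PartialPerm; exact: Prop_irrelevance.
Qed.

(** A point is sent to the sequence of its memberships in the separating
clopen sets. *)
Lemma compact_clopen_separated_full_transf (X : topologicalType) :
  compact [set: X] -> countably_clopen_separated X ->
  homeomorphic_to_subspace X full_transf.
Proof.
move=> cX [C [cC sC]].
pose f x : full_transf := fun n => nat_of_bool `[< C n x >].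
apply: (@compact_homeomorphic_to_subspace _ _ f cX).
- exact/zero_dimensional_hausdorff/countably_clopen_separated_zero_dimensional
    /full_transf_clopen_separated.
- apply: continuous_full_transf => k [|[|n]].
  + rewrite (_ : mkset _ = ~` C k); first exact/closed_openC/(cC k).2.
    by apply/seteqP; split=> x /=; rewrite /f; case: asboolP.
  + rewrite (_ : mkset _ = C k); first exact: (cC k).1.
    by apply/seteqP; split=> x /=; rewrite /f; case: asboolP.
  + rewrite (_ : mkset _ = set0); first exact: open0.
    by apply/seteqP; split=> x //=; rewrite /f; case: asboolP.
- move=> x y fxy; apply: sC => n; have := congr1 (@^~ n) fxy.
  by rewrite /f; do 2!case: asboolP.
Qed.

Definition diagonal_perm (A : set nat) : partial_perm.
Proof.
by refine (@PartialPerm [set p | p.1 = p.2 /\ A p.1] _ _);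
  move=> x y z /= [-> _] [-> _].
Defined.

(** A point is sent to the partial identity on the set of indices of the
separating clopen sets to which it belongs; the preimages of the subbasic sets
are then empty, some [C n], or the complement of some [C n]. *)
Lemma compact_clopen_separated_partial_perm (X : topologicalType) :
  compact [set: X] -> countably_clopen_separated X ->
  homeomorphic_to_subspace X partial_perm.
Proof.
move=> cX [C [cC sC]].
pose f x := diagonal_perm [set n | C n x].
have oC n : open (~` C n) by exact/closed_openC/(cC n).2.
apply: (@compact_homeomorphic_to_subspace _ _ f cX).
- exact/zero_dimensional_hausdorff/countably_clopen_separated_zero_dimensional
    /partial_perm_clopen_separated.
- apply: continuous_partial_perm => U [[|]|].
  + move=> [m [n ->]]; have [->|mn] := eqVneq m n.
      rewrite (_ : _ @^-1` _ = C n); first exact: (cC n).1.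
      by apply/seteqP; split=> x //= [].
    rewrite (_ : _ @^-1` _ = set0); first exact: open0.
    by apply/seteqP; split=> x //= [/= E]; rewrite E eqxx in mn.
  + move=> [n ->]; rewrite (_ : _ @^-1` _ = ~` C n)//.
    apply/seteqP; split=> x /= nC; first by move=> Cn; apply: nC; exists n.
    by case=> m [].
  + move=> [n ->]; rewrite (_ : _ @^-1` _ = ~` C n)//.
    apply/seteqP; split=> x /= nC; first by move=> Cn; apply: nC; exists n.
    by case=> m [/= ->].
- move=> x y fxy; apply: sC => n; have /= E := congr1 graph fxy.
  have := congr1 (@^~ (n, n)) E => /=.
  by move=> /propeqP; tauto.
Qed.

(** * Metrizability *)

Definition separating_index (X : topologicalType) (C : nat -> set X)
    (x y : X) : pred nat :=
  fun n => `[< C n x >] != `[< C n y >].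

(** The ultrametric of the Cantor space, seen through the memberships in the
sets [C n]: [1 / (n + 1)] for the least [n] such that [C n] separates the
points, and [0] if there is none. *)
Definition first_difference (R : realType) (X : topologicalType)
    (C : nat -> set X) (x y : X) : R :=
  if pselect (exists n, separating_index C x y n) is left e
  then (ex_minn e).+1%:R^-1%R else 0%R.

Lemma first_difference_lt (R : realType) (X : topologicalType)
    (C : nat -> set X) (x y : X) (n : nat) :
  (forall k, (k <= n)%N -> ~~ separating_index C x y k) ->
  (first_difference R C x y < n.+1%:R^-1)%R.
Proof.
move=> nsep; rewrite /first_difference; case: pselect => [e|_]; last first.
  by rewrite invr_gt0 ltr0n.
case: ex_minnP => m sm _; rewrite ltf_pV2 ?posrE ?ltr0n// ltr_nat ltnS ltnNge.
by apply: contraL sm => /nsep.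
Qed.

Lemma first_difference_ge (R : realType) (X : topologicalType)
    (C : nat -> set X) (x y : X) (n : nat) :
  separating_index C x y n -> (n.+1%:R^-1 <= first_difference R C x y)%R.
Proof.
move=> sn; rewrite /first_difference; case: pselect => [e|[]]; last by exists n.
case: ex_minnP => m _ /(_ n sn) mn.
by rewrite lef_pV2 ?posrE ?ltr0n// ler_nat.
Qed.

Lemma first_difference_ge0 (R : realType) (X : topologicalType)
    (C : nat -> set X) (x y : X) : (0 <= first_difference R C x y)%R.
Proof.
by rewrite /first_difference; case: pselect => // e; rewrite invr_ge0 ler0n.
Qed.

Lemma first_differencexx (R : realType) (X : topologicalType)
    (C : nat -> set X) (x : X) : first_difference R C x x = 0%R.
Proof.
rewrite /first_difference; case: pselect => // e; exfalso; case: e => n.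
by rewrite /separating_index eqxx.
Qed.

Lemma first_difference_sym (R : realType) (X : topologicalType)
    (C : nat -> set X) (x y : X) :
  first_difference R C x y = first_difference R C y x.
Proof.
have E : separating_index C x y = separating_index C y x.
  by apply/funext => n; rewrite /separating_index eq_sym.
by rewrite /first_difference E.
Qed.

(** An index that separates [x] from [z] separates [x] from [y] or [y] from
[z], so one of the two distances on the right is already large enough. *)
Lemma first_difference_triangle (R : realType) (X : topologicalType)
    (C : nat -> set X) (y x z : X) :
  (first_difference R C x z <=
     first_difference R C x y + first_difference R C y z)%R.
Proof.
rewrite {1}/first_difference; case: pselect => [e|_]; last first.
  by rewrite addr_ge0 ?first_difference_ge0.
case: ex_minnP => n xz _.
have [xy|xy] := boolP (separating_index C x y n).
  by rewrite ler_wpDr ?first_difference_ge0 ?first_difference_ge.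
rewrite ler_wpDl ?first_difference_ge0 ?first_difference_ge//.
by move: xz xy; rewrite /separating_index negbK => + /eqP <-.
Qed.

Lemma first_difference_positivity (R : realType) (X : topologicalType)
    (C : nat -> set X) (x y : X) : clopen_separation C ->
  first_difference R C x y = 0%R -> x = y.
Proof.
move=> [_ sC] d0; apply: sC => n; have [|] := boolP (separating_index C x y n).
  by move/(first_difference_ge R); rewrite d0 leNgt invr_gt0 ltr0n.
by rewrite /separating_index negbK => /eqP; do 2!case: asboolP.
Qed.

(** A copy of the carrier that forgets its topology, so that a metric can be put
on it without clashing with the topology already there. *)
Definition choice_carrier (X : choiceType) : Type := X.
HB.instance Definition _ (X : choiceType) := Choice.on (choice_carrier X).

(** The identity to the first-difference metric is continuous because a ball
of radius more than [1 / (n + 1)] contains all points with the same memberships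
in [C 0] to [C n], a clopen condition. It is a homeomorphism since the source
is compact and metric spaces are Hausdorff. *)
Lemma compact_clopen_separated_metrizable (R : realType) (X : topologicalType) :
  compact [set: X] -> countably_clopen_separated X -> metrizable R X.
Proof.
move=> cX [C sepC].
pose T := choice_carrier X.
pose M : metricType R := HB.pack T (Choice.class T) (isMetric.Build R T
  (@first_differencexx R X C)
  (fun x y => @first_difference_positivity R X C x y sepC)
  (@first_difference_sym R X C) (@first_difference_triangle R X C)).
exists M.
pose f : X -> M := id; pose g : M -> X := id.
have cf : continuous f.
  move=> x; apply/metricType_numDomainType.cvgrPdist_lt => e e0.
  have [//|n] := @ltr_add_invr R 0%R e _; rewrite add0r => ne.
  suff : \forall y \near x,
      forall k : nat, (k <= n)%N -> ~~ separating_index C x y k.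
    apply: filterS => y xy; apply: lt_trans ne.
    exact: first_difference_lt.
  have E k : nbhs x [set y | ~~ separating_index C x y k].
    have [Cx|nCx] := pselect (C k x).
      apply: (@filterS _ _ _ (C k)) => [y Cy /=|].
        by rewrite /separating_index negbK; apply/eqP; rewrite !asboolT.
      by apply: open_nbhs_nbhs; split=> //; exact: (sepC.1 k).1.
    apply: (@filterS _ _ _ (~` C k)) => [y Cy /=|].
      by rewrite /separating_index negbK; apply/eqP; rewrite !asboolF.
    by apply: open_nbhs_nbhs; split=> //; exact/closed_openC/(sepC.1 k).2.
  elim: n {ne} => [|n IH].
    by apply: filterS (E 0) => y y0 k; rewrite leqn0 => /eqP ->.
  apply: filterS2 IH (E n.+1) => y yn ySn k.
  by rewrite leq_eqVlt => /orP[/eqP -> //|]; exact: yn.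
exists f, g; split=> //.
apply/continuousP => U oU; rewrite -closedC.
rewrite (_ : ~` _ = f @` (~` U)).
  apply: compact_closed_image => //; first exact: metric_hausdorff.
  exact: open_closedC.
by rewrite image_id.
Qed.

Lemma homeomorphic_compact (X Y : topologicalType) :
  homeomorphic X Y -> compact [set: X] -> compact [set: Y].
Proof.
move=> [f [g [_ gK cf _]]] cX.
rewrite (_ : setT = f @` setT).
  by apply: continuous_compact => //; exact: continuous_subspaceT.
by apply/seteqP; split=> // y _; exists (g y).
Qed.

(** A compact metric space is second countable, and each clopen set is a
finite union of basic sets, so there are only countably many clopen sets: all of
them can be enumerated. *)
Lemma compact_metric_clopen_separated (R : realType) (M : metricType R) :
  compact [set: M] -> zero_dimensional M -> countably_clopen_separated M.
Proof.
move=> cM zM.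
(* Enumerating the clopen sets asks for a point of the space. *)
have [[x0 _]|M0] := pselect ([set: M] !=set0); last first.
  exists (fun=> set0); split=> [_|x y _]; first exact: clopen0.
  by case: M0; exists x.
pose pM : pseudoPMetricType R := HB.pack (Metric.sort M)
  (Metric.class M) (isPointed.Build M x0).
have [C] := @clopen_surj R pM cM.
exists C; split=> [n|x y xy]; first exact: (@funS _ _ _ _ C n).
apply: contrapT => /eqP /zM[U [cU Ux nUy]]; apply: nUy.
by have [n _ CU] := @surj _ _ _ _ C U cU; rewrite -CU; apply/xy; rewrite CU.
Qed.

Lemma compact_metrizable_clopen_separated (R : realType) (X : topologicalType) :
  compact [set: X] -> metrizable R X -> totally_disconnected [set: X] ->
  countably_clopen_separated X.
Proof.
move=> cX [M XM] tdX; have cM := homeomorphic_compact XM cX.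
case: XM => f [g [fK gK cf cg]].
have zX : zero_dimensional X.
  apply: compact_totally_disconnected_zero_dimensional => // x y clxy.
  apply: (can_inj fK); apply: (@metric_hausdorff _ M) => A B fA fB.
  have [z [Az Bz]] := clxy _ _ (cf _ _ fA) (cf _ _ fB).
  by exists (f z).
apply: (countably_clopen_separated_injective cf (can_inj fK)).
apply: (compact_metric_clopen_separated cM) => x y xy.
have [|U [cU Ux Uy]] := zX (g x) (g y).
  by apply: contra_neq xy => /(can_inj gK).
by exists (g @^-1` U); split=> //; exact: preimage_clopen.
Qed.

(** * Actions on the classes of open right congruences *)

(** By compactness an equivalence relation with open classes has finitely many
of them, so a class can be named by the position of its first representative in
a finite list. *)
Lemma compact_open_equivalence_index (X : topologicalType)
    (r : X -> X -> Prop) :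
  compact [set: X] -> (forall x, r x x) -> (forall x y, r x y -> r y x) ->
  (forall x y z, r x y -> r y z -> r x z) -> (forall x, open (r x)) ->
  exists c : X -> nat, forall x y, c x = c y <-> r x y.
Proof.
move=> cX rr rs rt ro.
have [||s _ scov] := @compact_finite_subcover X X setT r cX.
- by move=> x _; exact: ro.
- by move=> x; exists x.
exists (fun x => find (fun i => `[< r i x >]) s) => x y; split=> [cxy|rxy].
  have has_s z : has (fun i => `[< r i z >]) s.
    by apply/hasP; have [i si ri] := scov z; exists i => //; exact/asboolP.
  have := nth_find x (has_s y); have := nth_find x (has_s x).
  rewrite -cxy => /asboolP rx /asboolP ry; exact: rt (rs _ _ rx) ry.
apply: eq_find => i; apply/asboolP/asboolP => ri; first exact: rt ri rxy.
exact: rt ri (rs _ _ rxy).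
Qed.

(** The syntactic right congruence of [C] computed in the monoid obtained from
[S] by adjoining an identity: the first conjunct is the case where [u] is that
identity. It makes [C] a union of classes. *)
Definition right_syntactic (S : topologicalSemigroupType) (C : set S)
    (x y : S) : Prop :=
  (C x <-> C y) /\ forall u, C (x * u)%g <-> C (y * u)%g.

Lemma right_syntactic_mul (S : topologicalSemigroupType) (C : set S)
    (x y s : S) :
  right_syntactic C x y -> right_syntactic C (x * s)%g (y * s)%g.
Proof.
by move=> [_ xy]; split=> [|u]; [exact: xy|rewrite -!mulgA; exact: xy].
Qed.

Lemma near_mem_iff (X : topologicalType) (C : set X) (x : X) :
  clopen C -> \forall y \near x, C x <-> C y.
Proof.
move=> [oC cC]; have [Cx|nCx] := pselect (C x).
  by apply: filterS (open_nbhs_nbhs (conj oC Cx)) => y.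
by apply: filterS (open_nbhs_nbhs (conj (closed_openC cC) nCx)) => y.
Qed.

(** Membership of [z * u] in the clopen set [C] is locally constant in the pair
[(z, u)]. As [u] ranges over a compact space, the tube lemma gives one
neighbourhood of [z] that works for all [u]. *)
Lemma right_syntactic_open (S : topologicalSemigroupType) (C : set S) (x : S) :
  compact [set: S] -> clopen C -> open (right_syntactic C x).
Proof.
move=> cS cC.
have near_x z : \forall y \near z, right_syntactic C z y.
  have /compact_near_coveringP nc := cS.
  have H : \forall y \near z, setT `<=` (fun u => C (z * u)%g <-> C (y * u)%g).
    apply: (nc S (nbhs z) (fun y u => C (z * u)%g <-> C (y * u)%g)) => u _.
    have cz := near_mem_iff (z * u)%g cC.
    have : nbhs (z, u) [set p : S * S | C (z * u)%g <-> C (p.1 * p.2)%g].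
      exact: (@mulg_continuous S (z, u) _ cz).
    move=> [[A B] /= [Az Bu] AB].
    exists (B, A) => //= -[v y] /= [Bv Ay].
    have := AB (y, v) (conj Ay Bv).
    have := AB (z, v) (conj (nbhs_singleton Az) Bv).
    by rewrite /=; tauto.
  apply: filterS2 (near_mem_iff z cC) H => y Cy /= Cuy.
  by split=> // u; exact: Cuy.
rewrite openE => y [xy xyu]; apply: filterS (near_x y) => z [yz yzu].
by split=> [|u]; [rewrite xy|rewrite xyu].
Qed.

Definition right_compatible (S : topologicalSemigroupType)
    (c : nat -> S -> nat) : Prop :=
  forall n x y s, c n x = c n y -> c n (x * s)%g = c n (y * s)%g.

(** [S] acts by right translation on the classes of the [n]-th congruence.
[(n, Some m)] stands for the class named [m] and [(n, None)] for the class of the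
adjoined identity, which is moved to the class of [s]; this point makes the
action faithful even if [S] has no identity. Pairs that name no class are
fixed. *)
Definition class_act (S : topologicalSemigroupType) (c : nat -> S -> nat)
    (s : S) (p : nat * option nat) : nat * option nat :=
  if p.2 is Some m then
    if pselect (exists x, c p.1 x = m) is left e then
      (p.1, Some (c p.1 (projT1 (cid e) * s)%g))
    else p
  else (p.1, Some (c p.1 s)).

Lemma class_act_class (S : topologicalSemigroupType) (c : nat -> S -> nat)
    (s : S) (n : nat) (x : S) :
  right_compatible c ->
  class_act c s (n, Some (c n x)) = (n, Some (c n (x * s)%g)).
Proof.
move=> cM; rewrite /class_act /=; case: pselect => [e|[]]; last by exists x.
by rewrite (cM _ _ _ s (projT2 (cid e))).
Qed.

Lemma class_act_mul (S : topologicalSemigroupType) (c : nat -> S -> nat)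
    (s t : S) (p : nat * option nat) :
  right_compatible c ->
  class_act c (s * t)%g p = class_act c t (class_act c s p).
Proof.
move=> cM; case: p => n [m|]; last by rewrite {3}/class_act class_act_class//.
have [[x <-]|nm] := pselect (exists x, c n x = m).
  by rewrite !class_act_class// mulgA.
have fix_ u : class_act c u (n, Some m) = (n, Some m).
  by rewrite /class_act /=; case: pselect.
by rewrite !fix_.
Qed.

(** The action transported to [nat]: points are coded by natural numbers and
the numbers that code no point are fixed. *)
Definition coded_act (S : topologicalSemigroupType) (c : nat -> S -> nat)
    (s : S) : full_transf := fun k =>
  if unpickle k is Some p then pickle (class_act c s p) else k.

Lemma coded_act_pickle (S : topologicalSemigroupType) (c : nat -> S -> nat)
    (s : S) (p : nat * option nat) :
  coded_act c s (pickle p) = pickle (class_act c s p).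
Proof. by rewrite /coded_act pickleK. Qed.

Lemma coded_act_mul (S : topologicalSemigroupType) (c : nat -> S -> nat) :
  right_compatible c -> {morph coded_act c : s t / (s * t)%g}.
Proof.
move=> cM s t; apply/funext => k; rewrite transf_mulE {1 3}/coded_act.
case E : (unpickle k) => [p|]; first by rewrite coded_act_pickle class_act_mul.
by rewrite /coded_act E.
Qed.

(** The image of the adjoined identity of the [n]-th congruence is the class of
[s], so the transformation determines every [c n s]. *)
Lemma coded_act_injective (S : topologicalSemigroupType) (c : nat -> S -> nat) :
  (forall x y, (forall n, c n x = c n y) -> x = y) -> injective (coded_act c).
Proof.
move=> cI s t st; apply: cI => n.
have := congr1 (@^~ (pickle (n, @None nat))) st.
by rewrite !coded_act_pickle => /(pcan_inj pickleK)[].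
Qed.

(** The value at a fixed class [x] is the class of [x * s], which is locally
constant in [s] because classes are open and multiplication is continuous. *)
Lemma coded_act_continuous (S : topologicalSemigroupType) (c : nat -> S -> nat) :
  right_compatible c ->
  (forall n (x : S), open [set y | c n y = c n x]) ->
  continuous (coded_act c).
Proof.
move=> cM oc; apply: continuous_full_transf => k m.
rewrite openE => s /= sm.
suff : nbhs s [set t | coded_act c t k = coded_act c s k].
  by apply: filterS => t ts; exact: etrans ts sm.
rewrite {1 2}/coded_act; case: unpickle => [[n [i|]]|]; last exact: filterE.
- have [[x <-]|nx] := pselect (exists x, c n x = i).
    have near_s : \forall t \near s, c n (x * t)%g = c n (x * s)%g.
      have near_xs := open_nbhs_nbhs (conj (oc n (x * s)%g) erefl).
      have : nbhs (x, s) [set p : S * S | c n (p.1 * p.2)%g = c n (x * s)%g].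
        exact: (@mulg_continuous S (x, s) _ near_xs).
      move=> [[A B] /= [Ax Bs] AB]; apply: filterS Bs => t Bt.
      exact: (AB (x, t) (conj (nbhs_singleton Ax) Bt)).
    by apply: filterS near_s => t /= E; rewrite !class_act_class// E.
  by apply: filterE => t /=; rewrite /class_act /=; case: pselect.
- apply: filterS (open_nbhs_nbhs (conj (oc n s) erefl)) => t /= E.
  by rewrite /class_act /= E.
Qed.

(** The syntactic right congruences of the separating clopen sets have finitely
many open classes, and together they separate points because [C n] is a union of
classes of its own congruence. The joint action on all the classes is the
embedding. *)
Lemma compact_clopen_separated_embeds (S : topologicalSemigroupType) :
  compact [set: S] -> countably_clopen_separated S ->
  embeds_topologically S full_transf.
Proof.
move=> cS [C [cC sC]].
have ex n : {c : S -> nat | forall x y, c x = c y <-> right_syntactic (C n) x y}.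
  apply/cid/compact_open_equivalence_index => //.
  - by move=> x y [xy xyu]; split=> [|u]; [rewrite xy|rewrite xyu].
  - by move=> x y z [xy xyu] [yz yzu]; split=> [|u]; [rewrite xy|rewrite xyu].
  - by move=> x; exact: right_syntactic_open.
pose c n := projT1 (ex n).
have cP n x y : c n x = c n y <-> right_syntactic (C n) x y := projT2 (ex n) x y.
have cM n x y s : c n x = c n y -> c n (x * s)%g = c n (y * s)%g.
  by move=> /cP xy; apply/cP; exact: right_syntactic_mul.
have cI x y : (forall n, c n x = c n y) -> x = y.
  by move=> xy; apply: sC => n; case/cP: (xy n).
have co n (x : S) : open [set y | c n y = c n x].
  rewrite (_ : mkset _ = right_syntactic (C n) x).
    exact: right_syntactic_open.
  by apply/seteqP; split=> y /= => [/esym/cP|/cP/esym].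
have rI := coded_act_injective cI; have rc := coded_act_continuous cM co.
pose phi : {multiplicative S -> full_transf} :=
  HB.pack (coded_act c)
    (isMultiplicative.Build S full_transf (coded_act c) (coded_act_mul cM)).
exists phi; split=> //.
apply: compact_injective_inverse => //.
exact/zero_dimensional_hausdorff/countably_clopen_separated_zero_dimensional
    /full_transf_clopen_separated.
Qed.

Theorem theorem2p3 (R : realType) (S : topologicalSemigroupType)
    (S_compact : compact [set: S]) :
  [<-> homeomorphic_to_subspace S full_transf /\
         homeomorphic_to_subspace S partial_perm;
       embeds_topologically S full_transf;
       metrizable R S /\ totally_disconnected [set: S]].
Proof.
split; last split.
- move=> [/homeomorphic_to_subspace_injective[f cf fI] _].
  apply: compact_clopen_separated_embeds => //.
  exact: (countably_clopen_separated_injective cf fI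
    full_transf_clopen_separated).
- move=> [phi [phiI cphi _]].
  have sS := countably_clopen_separated_injective cphi phiI
    full_transf_clopen_separated.
  split; first exact: compact_clopen_separated_metrizable.
  apply: zero_dimension_totally_disconnected.
  exact: countably_clopen_separated_zero_dimensional.
- move=> [mS tdS].
  have sS := compact_metrizable_clopen_separated S_compact mS tdS.
  split; first exact: compact_clopen_separated_full_transf.
  exact: compact_clopen_separated_partial_perm.
Qed.
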